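(* Let $n\ge 1$. In $C(\mathrm{Qut}(\mathcal U_{K_n}))$ put $p_{a,x}=u_{a,x}^*u_{a,x}$ for $1\le a,x\le n$ and $u_i=\sum_{x,y=1}^n u_{i,x}^*u_{i+1,y}$ for $1\le i\le n-1$. Then the assignment $p_{a,x}\mapsto\delta_{a,x}1$, $u_i\mapsto w_i$ ($1\le a,x\le n$, $1\le i\le n-1$) defines a surjective $*$-homomorphism $\varphi: C(\mathrm{Qut}(\mathcal U_{K_n}))\to C^*(\mathbb F_{n-1})$.
   Context: $K_n$ is the complete graph on $n$ vertices. For a unital $C^*$-algebra $\mathcal B$, a matrix $U=(u_{i,j})_{i,j=1}^n\in M_n(\mathcal B)$ is a bi-unitary if both $U$ and $U^t=(u_{j,i})_{i,j=1}^n$ are unitary in $M_n(\mathcal B)$. Consider the universal unital $C^*$-algebra generated by elements $u_{i,j}$, $1\le i,j\le n$, subject to the relations that $U=(u_{i,j})_{i,j=1}^n$ is a bi-unitary, $u_{i,k}u_{i,l}^*=0$ for $k\ne l$, and $u_{i,k}u_{j,k}^*=0$ for $i\ne j$. The algebra $C(\mathrm{Qut}(\mathcal U_{K_n}))$ is its $C^*$-subalgebra generated by all the words $u_{i,j}^*u_{k,l}$, $1\le i,j,k,l\le n$. (The single-index symbols $u_i$ are distinct from the double-index symbols $u_{i,j}$.) $\mathbb F_m$ is the free group on $m$ generators ($\mathbb F_0$ is trivial), $C^*(\mathbb F_m)$ is its full group $C^*$-algebra, and $w_1,\dots,w_m$ are its canonical unitary generators. *)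

(* Defs.v *)
From HB Require Import structures.
From mathcomp Require Import all_boot all_order all_algebra.
From mathcomp Require Import all_classical all_reals.
From mathcomp Require Import complex.

Set Implicit Arguments.
Unset Strict Implicit.
Unset Printing Implicit Defensive.

Import Order.TTheory GRing.Theory Num.Theory.
Import ComplexField.Normc.

Local Open Scope classical_set_scope.
Local Open Scope ring_scope.

(* Unital C*-algebras over the complex field R[i], with a real-valued norm.
   Hierarchy-Builder has no join of the ring and the normed-module structures
   below numDomainType, hence the norm and completeness axioms are listed here
   instead of being inherited.  MathComp algebras are nontrivial rings, so the
   zero algebra is not a cstarAlgType. *)
HB.mixin Record isCStarAlgebra (R : realType) A of GRing.Algebra R[i] A := {
  star : A -> A ;
  cnorm : A -> R ;
  starK : involutive star ;
  starD : {morph star : x y / x + y} ;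
  starZ : forall (c : R[i]) (x : A), star (c *: x) = Num.conj c *: star x ;
  starM : forall x y : A, star (x * y) = star y * star x ;
  cnorm_eq0 : forall x : A, cnorm x = 0 -> x = 0 ;
  cnormD : forall x y : A, cnorm (x + y) <= cnorm x + cnorm y ;
  cnormZ : forall (c : R[i]) (x : A), cnorm (c *: x) = normc c * cnorm x ;
  cnormM : forall x y : A, cnorm (x * y) <= cnorm x * cnorm y ;
  cnorm_star : forall x : A, cnorm (star x * x) = cnorm x ^+ 2 ;
  cnorm_complete : forall v : nat -> A,
    (forall e : R, 0 < e -> exists N : nat, forall m k : nat,
      (N <= m)%N -> (N <= k)%N -> cnorm (v m - v k) < e) ->
    exists l : A, forall e : R, 0 < e -> exists N : nat, forall m : nat,
      (N <= m)%N -> cnorm (v m - l) < e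
}.

#[short(type="cstarAlgType")]
HB.structure Definition CStarAlgebra (R : realType) :=
  {A of GRing.Algebra R[i] A & isCStarAlgebra R A}.

Section CStarAlgebras.
Context {R : realType}.
Implicit Types A B : cstarAlgType R.

Record cstar_subalgebra A (S : set A) : Prop := {
  cstar_sub0 : S 0 ;
  cstar_subD : forall x y, S x -> S y -> S (x + y) ;
  cstar_subZ : forall (c : R[i]) x, S x -> S (c *: x) ;
  cstar_subM : forall x y, S x -> S y -> S (x * y) ;
  cstar_subV : forall x, S x -> S (star x) ;
  cstar_sub_closed : forall x,
    (forall e : R, 0 < e -> exists2 y, S y & cnorm (x - y) < e) -> S x
}.

Definition cstar_span A (X : set A) : set A := smallest (@cstar_subalgebra A) X.

(* A *-homomorphism with domain the *-subalgebra D of A: only the values of f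
   on D matter. *)
Record star_hom A B (D : set A) (f : A -> B) : Prop := {
  star_homD : forall x y, D x -> D y -> f (x + y) = f x + f y ;
  star_homZ : forall (c : R[i]) x, D x -> f (c *: x) = c *: f x ;
  star_homM : forall x y, D x -> D y -> f (x * y) = f x * f y ;
  star_homV : forall x, D x -> f (star x) = star (f x)
}.

(* (A, a) is the universal unital C*-algebra generated by elements a i
   (i in I) subject to the relations rel. *)
Record universal_cstar (I : Type)
    (rel : forall B : cstarAlgType R, (I -> B) -> Prop)
    A (a : I -> A) : Prop := {
  universal_rel : rel A a ;
  universal_gen : cstar_span ([set 1] `|` range a) = setT ;
  universal_map : forall (B : cstarAlgType R) (b : I -> B), rel B b ->
    exists f : A -> B,
      [/\ star_hom setT f, f 1 = 1 & forall i, f (a i) = b i]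
}.

Definition unitary A (x : A) := star x * x = 1 /\ x * star x = 1.

Definition adjmx A n (U : 'M[A]_n) : 'M[A]_n := \matrix_(i, j) star (U j i).

Definition unitary_mx A n (U : 'M[A]_n) :=
  adjmx U *m U = 1%:M /\ U *m adjmx U = 1%:M.

Definition biunitary_mx A n (U : 'M[A]_n) := unitary_mx U /\ unitary_mx U^T.

Definition KnRelations n A (u : 'I_n * 'I_n -> A) : Prop :=
  [/\ biunitary_mx (\matrix_(i, j) u (i, j)),
      forall i k l, k != l -> u (i, k) * star (u (i, l)) = 0
    & forall i j k, i != j -> u (i, k) * star (u (j, k)) = 0].

(* The subset C(Qut(U_{K_n})) of the universal algebra with generators u. *)
Definition CQut n A (u : 'I_n * 'I_n -> A) : set A :=
  cstar_span [set x | exists i j k l, x = star (u (i, j)) * u (k, l)].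

Definition qut_p n A (u : 'I_n * 'I_n -> A) (a x : 'I_n) : A :=
  star (u (a, x)) * u (a, x).

(* With 0-based indices, widen_ord and lift send i to the row i and to the
   next row i + 1. *)
Definition qut_u n A (u : 'I_n.+1 * 'I_n.+1 -> A) (i : 'I_n) : A :=
  \sum_(x < n.+1) \sum_(y < n.+1)
     star (u (widen_ord (leqnSn n) i, x)) * u (lift ord0 i, y).

Definition unitary_rep (G : groupType) A (w : G -> A) : Prop :=
  {morph w : g h / (g * h)%g >-> g * h} /\ forall g, unitary (w g).

(* (A, w) is the full group C*-algebra C^*(G), w being the canonical map. *)
Definition full_group_cstar (G : groupType) A (w : G -> A) : Prop :=
  universal_cstar (@unitary_rep G) w.

End CStarAlgebras.

Definition free_group m (F : groupType) (g : 'I_m -> F) : Prop :=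
  forall (H : groupType) (h : 'I_m -> H),
    exists! f : F -> H,
      {morph f : x y / (x * y)%g} /\ forall i, f (g i) = h i.

(* Main.v *)
(* The row sums s_i = \sum_x u_{i,x} are unitary, u_i = s_i^* s_{i+1} and
   u_{i,j}^* u_{k,l} = p_{i,j} (s_i^* s_k) p_{k,l}; since s_i^* s_k is a product
   of the u_m and their adjoints, the p_{a,x} and the u_i generate
   C(Qut(U_{K_n})), whence uniqueness.  For existence, the matrix diag(v_i) with
   v_0 = 1 and v_{i+1} = v_i w_i satisfies the K_n relations.  The u_i being
   unitary, w_i |-> u_i extends to a *-homomorphism C^*(F) -> C(Qut(U_{K_n})),
   a section of phi, so phi is surjective without knowing that the image of a
   *-homomorphism is closed.  Equality of *-homomorphisms spreads from
   generators to closures by contractivity, which needs no spectral theory: a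
   self-adjoint h with |h| < 1 is the real part of the unitary
   h + i sqrt(1 - h^2). *)
Require Import Defs.
From HB Require Import structures.
From mathcomp Require Import all_boot all_order all_algebra.
From mathcomp Require Import all_classical all_reals.
From mathcomp Require Import complex lra topology normedtype sequences.
Import Order.TTheory GRing.Theory Num.Theory.
Import numFieldNormedType.Exports.
Local Open Scope classical_set_scope.
Local Open Scope ring_scope.

Set Implicit Arguments.
Unset Strict Implicit.
Unset Printing Implicit Defensive.

(** * Consequences of the C*-identity for the norm and the involution *)

Section CStarNorm.
Context {R : realType} {A : cstarAlgType R}.
Implicit Types x y : A.

Lemma normc_real (c : R) : ComplexField.Normc.normc (c%:C)%C = `|c|.
Proof. by rewrite /ComplexField.Normc.normc /= expr0n /= addr0 sqrtr_sqr. Qed.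

Lemma conj_real (c : R) : Num.conj (c%:C)%C = (c%:C)%C.
Proof. by apply: conj_Creal; rewrite complex_real. Qed.

Lemma star0 : star (0 : A) = 0.
Proof. by rewrite -(scale0r (0 : A)) starZ rmorph0 !scale0r. Qed.

Lemma starN x : star (- x) = - star x.
Proof. by apply: (addIr (star x)); rewrite -starD !addNr star0. Qed.

Lemma starB x y : star (x - y) = star x - star y.
Proof. by rewrite starD starN. Qed.

Lemma star1 : star (1 : A) = 1.
Proof. by rewrite -[LHS]mul1r -[X in X * _]starK -starM mul1r starK. Qed.

Lemma star_sum I (r : seq I) (P : pred I) (E : I -> A) :
  star (\sum_(i <- r | P i) E i) = \sum_(i <- r | P i) star (E i).
Proof. exact: (big_morph _ starD star0). Qed.

Lemma cnorm0 : cnorm (0 : A) = 0.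
Proof.
by rewrite -(scale0r (0 : A)) cnormZ ComplexField.Normc.normc0 mul0r.
Qed.

Lemma cnormZr (c : R) x : cnorm ((c%:C)%C *: x) = `|c| * cnorm x.
Proof. by rewrite cnormZ normc_real. Qed.

Lemma cnormN x : cnorm (- x) = cnorm x.
Proof.
rewrite -[- x]scaleN1r.
have -> : (- 1 : R[i]%C) = ((- 1)%:C)%C by rewrite rmorphN1.
by rewrite cnormZr normrN1 mul1r.
Qed.

Lemma cnorm_ge0 x : 0 <= cnorm x.
Proof. by have := cnormD x (- x); rewrite subrr cnorm0 cnormN; lra. Qed.

Lemma cnormC x y : cnorm (x - y) = cnorm (y - x).
Proof. by rewrite -cnormN opprB. Qed.

Lemma cnorm_le0 x : cnorm x <= 0 -> x = 0.
Proof. by move=> h; apply: cnorm_eq0; apply/le_anti; rewrite h cnorm_ge0. Qed.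

(** The C*-identity and submultiplicativity give [cnorm y ^+ 2 <= cnorm (star y) * cnorm y]; divide
    by [cnorm y] when it is positive, then apply this to [star x] as well. *)
Lemma cnormV x : cnorm (star x) = cnorm x.
Proof.
have le y : cnorm y <= cnorm (star y).
  have := cnorm_ge0 y; rewrite le_eqVlt => /orP[/eqP <-|y_gt0].
    exact: cnorm_ge0.
  by rewrite -(ler_pM2r y_gt0) -expr2 -cnorm_star cnormM.
by apply/le_anti; rewrite le -{2}(starK x) le.
Qed.

Lemma cnorm1_le : cnorm (1 : A) <= 1.
Proof.
have := cnorm_star (1 : A); rewrite star1 mul1r expr2 => h.
by have := cnorm_ge0 (1 : A); nra.
Qed.

Lemma cnorm_unitary x : unitary x -> cnorm x <= 1.
Proof.
move=> [xx _]; have := cnorm_star x; rewrite xx => h.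
by have := cnorm1_le; have := cnorm_ge0 x; nra.
Qed.

Lemma cnorm_dist x y z : cnorm (x - z) <= cnorm (x - y) + cnorm (y - z).
Proof. by rewrite -[x - z](subrKA y) cnormD. Qed.

Lemma cnorm_lim0 (C : R) x : (forall e, 0 < e -> cnorm x <= C * e) -> x = 0.
Proof.
move=> h; apply: cnorm_le0; rewrite leNgt; apply/negP => x_gt0.
have C_gt0 : 0 < 2 * (`|C| + 1) by have := normr_ge0 C; lra.
have := h (cnorm x / (2 * (`|C| + 1))) (divr_gt0 x_gt0 C_gt0).
apply/negP; rewrite -ltNge mulrA ltr_pdivrMr //.
by have := ler_norm C; have := normr_ge0 C; nra.
Qed.

End CStarNorm.

(** * C*-subalgebras and the C*-subalgebra generated by a set *)

Section Subalgebras.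
Context {R : realType} {A : cstarAlgType R}.
Implicit Types (S X : set A) (x y : A).

Lemma cstar_subN S x : cstar_subalgebra S -> S x -> S (- x).
Proof. by move=> hS Sx; rewrite -scaleN1r; apply: cstar_subZ. Qed.

Lemma cstar_subB S x y : cstar_subalgebra S -> S x -> S y -> S (x - y).
Proof. by move=> hS Sx Sy; apply: cstar_subD => //; apply: cstar_subN. Qed.

Lemma cstar_sub_sum S I (r : seq I) (P : pred I) (E : I -> A) :
  cstar_subalgebra S -> (forall i, P i -> S (E i)) ->
  S (\sum_(i <- r | P i) E i).
Proof.
move=> hS hE; apply: (big_ind S) => //; first exact: cstar_sub0.
exact: cstar_subD.
Qed.

Lemma cstar_subalgebraT : cstar_subalgebra [set: A].
Proof. by []. Qed.

Lemma cstar_span_subalgebra X : cstar_subalgebra (cstar_span X).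
Proof.
split=> [S [hS _]|x y Xx Xy S [hS XS]|c x Xx S [hS XS]|x y Xx Xy S [hS XS]
        |x Xx S [hS XS]|x Xx S [hS XS]].
- exact: cstar_sub0.
- by apply: cstar_subD => //; [apply: Xx|apply: Xy].
- by apply: cstar_subZ => //; apply: Xx.
- by apply: cstar_subM => //; [apply: Xx|apply: Xy].
- by apply: cstar_subV => //; apply: Xx.
- apply: (cstar_sub_closed hS) => e /Xx[y Xy xy].
  by exists y => //; apply: Xy.
Qed.

Lemma cstar_span_gen X : X `<=` cstar_span X.
Proof. exact: sub_gen_smallest. Qed.

Lemma cstar_span_min X S :
  cstar_subalgebra S -> X `<=` S -> cstar_span X `<=` S.
Proof. by move=> hS XS; apply: smallest_sub. Qed.

End Subalgebras.

Lemma expr_archi {R : realType} (q e : R) :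
  0 <= q < 1 -> 0 < e -> exists N : nat, q ^+ N < e.
Proof.
move=> /andP[q0 q1] e0.
have /cvgr0Pnorm_lt/(_ e e0)[N _ /(_ N (leqnn N))] : q ^+ n @[n --> \oo] --> 0.
  by apply: cvg_expr; rewrite ger0_norm.
by rewrite /= ger0_norm ?exprn_ge0 //; exists N.
Qed.

(** * The square root of [1 - h * h] as the limit of a contraction *)

Section ComplementRoot.
Context {R : realType} {A : cstarAlgType R}.
Variables (S : set A) (hS : cstar_subalgebra S) (h : A).
Hypotheses (Sh : S h) (h_sa : star h = h) (h_lt1 : cnorm h < 1).

Let half : R[i]%C := ((2^-1)%:C)%C.
Let step (y : A) : A := half *: (h * h + y * y).
Let approx (k : nat) : A := iter k step 0.
Let q := cnorm (h * h).

Let q_ge0 : 0 <= q. Proof. exact: cnorm_ge0. Qed.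

Let q_lt1 : q < 1.
Proof.
have := cnormM h h; rewrite -/q => hq; have := cnorm_ge0 h => h0.
by move: h_lt1; nra.
Qed.

Let cnorm_half (x : A) : cnorm (half *: x) = cnorm x / 2.
Proof. by rewrite cnormZr ger0_norm ?invr_ge0 // mulrC. Qed.

(** The ball of radius [q] is stable under [step] because [(q + q ^+ 2) / 2 <= q] for
    [0 <= q < 1]. *)
Let cnorm_approx k : cnorm (approx k) <= q.
Proof.
elim: k => [|k IH]; first by rewrite /approx /= cnorm0.
rewrite /approx /= -/(approx k) cnorm_half.
have := cnormD (h * h) (approx k * approx k).
have := cnormM (approx k) (approx k); have := cnorm_ge0 (approx k).
by move: IH q_lt1; rewrite -/q; nra.
Qed.

Let cnorm_stepB (x y : A) :
  cnorm (step x - step y) <= (cnorm x + cnorm y) / 2 * cnorm (x - y).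
Proof.
rewrite /step -scalerBr cnorm_half opprD addrACA subrr add0r.
have -> : x * x - y * y = x * (x - y) + (x - y) * y.
  by rewrite mulrBr mulrBl addrA subrK.
have := cnormD (x * (x - y)) ((x - y) * y).
have := cnormM x (x - y); have := cnormM (x - y) y.
by lra.
Qed.

(** On the ball of radius [q] the Lipschitz factor of [cnorm_stepB] is at most [q], so each common
    step gains a factor [q]. *)
Let approx_shift N k : cnorm (approx (N + k) - approx N) <= q ^+ N.
Proof.
elim: N => [|N IH].
  by rewrite expr0 add0n subr0; apply: le_trans (cnorm_approx k) (ltW q_lt1).
rewrite addSn /approx /= -/(approx (N + k)) -/(approx N) exprS.
apply: le_trans (cnorm_stepB _ _) _.
apply: ler_pM => //; try exact: cnorm_ge0.
  by have := cnorm_ge0 (approx (N + k)); have := cnorm_ge0 (approx N); lra.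
by have := cnorm_approx (N + k); have := cnorm_approx N; lra.
Qed.

(** The properties that every iterate has and that survive in the limit. *)
Let good := [set x : A | [/\ S x, star x = x & h * x = x * h]].

Let good_approx k : good (approx k).
Proof.
elim: k => [|k [Sk sk ck]].
  by split; [exact: cstar_sub0|exact: star0|rewrite mulr0 mul0r].
rewrite /approx /= -/(approx k); split.
- by apply: cstar_subZ => //; apply: cstar_subD => //; apply: cstar_subM.
- by rewrite starZ conj_real starD !starM sk h_sa.
- by rewrite /step -scalerAr -scalerAl mulrDr mulrDl !mulrA ck -!mulrA ck.
Qed.

Let good_closed (l : A) :
  (forall e : R, 0 < e -> exists2 k, good k & cnorm (k - l) < e) -> good l.
Proof.
move=> hl; split.
- apply: (cstar_sub_closed hS) => e /hl[k [Sk _ _] kl].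
  by exists k => //; rewrite cnormC.
- apply/subr0_eq; apply: (@cnorm_lim0 _ _ 2) => e /hl[k [_ sk _] kl].
  have := cnorm_dist (star l) (star k) l.
  by rewrite -starB cnormV (cnormC l) sk; move: kl; lra.
- apply/subr0_eq; apply: (@cnorm_lim0 _ _ (2 * cnorm h)) => e.
  move=> /hl[k [_ _ ck] kl].
  have -> : h * l - l * h = (k - l) * h - h * (k - l).
    by rewrite mulrBl mulrBr ck opprB [RHS]addrC subrKA.
  have := cnormD ((k - l) * h) (- (h * (k - l))); rewrite cnormN.
  have := cnormM (k - l) h; have := cnormM h (k - l); have := cnorm_ge0 h.
  by move: kl; nra.
Qed.

(* The root is [1 - y], where [y] solves [y = (h^2 + y^2) / 2]; the map
   [y |-> (h^2 + y^2) / 2] is a contraction of the ball of radius [|h^2|]. *)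
Lemma complement_root : S 1 ->
  exists k, [/\ S k, star k = k, h * k = k * h & h * h + k * k = 1].
Proof.
move=> S1.
have [e e0|l hl] := cnorm_complete approx.
  have [|N hN] := @expr_archi _ q (e / 2) _ (divr_gt0 e0 (ltr0Sn R 1)).
    by rewrite q_ge0.
  exists N => m k Nm Nk; apply: le_lt_trans (cnorm_dist _ (approx N) _) _.
  rewrite (cnormC (approx N)).
  have := approx_shift N (m - N); have := approx_shift N (k - N).
  by rewrite !subnKC //; lra.
have hl2 e : 0 < e -> exists k, cnorm (approx k - l) < e /\
                               cnorm (approx k.+1 - l) < e.
  move=> /hl[N hN]; exists N; split; apply: hN => //; exact: leqW.
have [Sl sl cl] : good l.
  by apply: good_closed => e /hl2[k [kl _]]; exists (approx k).
have fix_l : step l = l.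
  (* Going through [approx k.+1 = step (approx k)], the distance from [step l] to [l] is at most
     [((cnorm l + q) / 2 + 1) * e]. *)
  apply/subr0_eq; apply: (@cnorm_lim0 _ _ (cnorm l + 2)) => e /hl2[k [kl k1l]].
  have := cnorm_dist (step l) (approx k.+1) l.
  rewrite {1}/approx iterS -/(approx k).
  have := cnorm_stepB l (approx k); rewrite (cnormC l).
  have := cnorm_approx k; have := cnorm_ge0 l; have := cnorm_ge0 (approx k).
  have := cnorm_ge0 (approx k - l).
  by move: kl k1l q_lt1; nra.
exists (1 - l); split.
- exact: cstar_subB.
- by rewrite starB star1 sl.
- by rewrite mulrBr mulrBl mulr1 mul1r cl.
(* This is the fixed-point equation solved for [h * h]; its right side is [1] minus the square of
   [1 - l]. *)
- have ll : h * h = l + l - l * l.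
    rewrite -{1 2}fix_l /step -scalerDl /half -rmorphD /=.
    have -> : 2^-1 + 2^-1 = 1 :> R by lra.
    by rewrite rmorph1 scale1r addrK.
  rewrite ll mulrBr mulr1 mulrBl mul1r opprB [1 - l + _]addrACA -opprD.
  rewrite -[1 + _ - _]addrA.
  by rewrite -[l * l - _]opprB addrCA subrr addr0.
Qed.

End ComplementRoot.

(** * Contractivity of unital *-homomorphisms and closed preimages *)

Section StarHomTheory.
Context {R : realType} {A B : cstarAlgType R}.
Variables (S : set A) (hS : cstar_subalgebra S) (f : A -> B).
Hypothesis hf : star_hom S f.
Implicit Types x y : A.

Lemma star_hom0 : f 0 = 0.
Proof.
by rewrite -(scale0r (0 : A)) (star_homZ hf) ?scale0r //; apply: cstar_sub0.
Qed.

Lemma star_homN x : S x -> f (- x) = - f x.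
Proof. by move=> Sx; rewrite -scaleN1r (star_homZ hf) // scaleN1r. Qed.

Lemma star_homB x y : S x -> S y -> f (x - y) = f x - f y.
Proof.
by move=> Sx Sy; rewrite (star_homD hf) ?star_homN //; apply: cstar_subN.
Qed.

Lemma star_hom_sum I (r : seq I) (E : I -> A) :
  (forall i, S (E i)) -> f (\sum_(i <- r) E i) = \sum_(i <- r) f (E i).
Proof.
move=> SE; elim: r => [|i r IH]; first by rewrite !big_nil star_hom0.
by rewrite !big_cons (star_homD hf) ?IH //; apply: cstar_sub_sum.
Qed.

Hypotheses (S1 : S 1) (f1 : f 1 = 1).

Lemma star_hom_unitary x : S x -> unitary x -> unitary (f x).
Proof.
move=> Sx [xx xx']; have Sx' := cstar_subV hS Sx.
by split; rewrite -(star_homV hf) // -(star_homM hf) // ?xx ?xx'.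
Qed.

(* With [k = sqrt (1 - h^2)], [h] is the real part of the unitary [h + i k]. *)
Lemma star_hom_sa_ball h :
  S h -> star h = h -> cnorm h < 1 -> cnorm (f h) <= 1.
Proof.
move=> Sh sh h1; have [k [Sk sk ck hk]] := complement_root hS Sh sh h1 S1.
pose v := h + 'i *: k.
have Sv : S v by apply: cstar_subD => //; apply: cstar_subZ.
have vE : star v = h - 'i *: k by rewrite starD starZ sh sk conjCi scaleNr.
have ii : 'i * 'i = - 1 :> R[i]%C by rewrite -expr2 sqrCi.
have uv : unitary v.
  rewrite /unitary vE /v; split.
    rewrite mulrDl !mulrDr !mulNr -!scalerAr -!scalerAl ck scalerA ii.
    by rewrite scaleN1r opprK addrA addrK.
  rewrite mulrDl !mulrBr -!scalerAr -!scalerAl ck scalerA ii.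
  by rewrite scaleN1r opprK addrA subrK.
(* Twice [f h] is thus a sum of two elements of norm at most 1, as [f v] is unitary. *)
have fvE : f v + star (f v) = f h + f h.
  rewrite -(star_homV hf) // -!(star_homD hf) //; last exact: cstar_subV.
  by rewrite vE /v addrACA subrr addr0.
have := cnormD (f v) (star (f v)); rewrite fvE cnormV.
have -> : f h + f h = ((2 : R)%:C)%C *: f h.
  by rewrite -(natr1 1) rmorphD rmorph1 scalerDl !scale1r.
rewrite cnormZr ger0_norm //.
by have := cnorm_unitary (star_hom_unitary Sv uv); lra.
Qed.

(** Dividing by [cnorm h + e] moves [h] into the open unit ball; then [e] tends to 0. *)
Lemma star_hom_sa_contractive h :
  S h -> star h = h -> cnorm (f h) <= cnorm h.
Proof.
move=> Sh sh; apply/ler_addgt0Pr => e e0; set t := cnorm h + e.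
have t0 : 0 < t by have := cnorm_ge0 h; rewrite /t; lra.
have t0' : 0 < t^-1 by rewrite invr_gt0.
have := @star_hom_sa_ball ((t^-1)%:C%C *: h).
rewrite (star_homZ hf) // !cnormZr gtr0_norm // starZ conj_real sh.
rewrite -[_ < 1](ltr_pM2l t0) mulVKf ?gt_eqF // mulr1.
rewrite -[_ <= 1](ler_pM2l t0) mulVKf ?gt_eqF // mulr1; apply => //.
  exact: cstar_subZ.
by rewrite /t; lra.
Qed.

(** The C*-identity reduces the claim to the self-adjoint element [star x * x]. *)
Lemma star_hom_contractive x : S x -> cnorm (f x) <= cnorm x.
Proof.
move=> Sx; have Sx' := cstar_subV hS Sx.
rewrite -(@ler_pXn2r _ 2) ?nnegrE ?cnorm_ge0 // -!cnorm_star.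
rewrite -(star_homV hf) // -(star_homM hf) //.
apply: star_hom_sa_contractive; first exact: cstar_subM.
by rewrite starM starK.
Qed.

(** Contractivity makes the preimage closed; the algebraic closure properties are immediate. *)
Lemma star_hom_preimage (T : set B) :
  cstar_subalgebra T -> cstar_subalgebra (S `&` f @^-1` T).
Proof.
move=> hT; split=> [|x y [Sx Tx] [Sy Ty]|c x [Sx Tx]|x y [Sx Tx] [Sy Ty]
                   |x [Sx Tx]|x hx].
- by split; [|rewrite /= star_hom0]; apply: cstar_sub0.
- by split; [|rewrite /= (star_homD hf) //]; apply: cstar_subD.
- by split; [|rewrite /= (star_homZ hf) //]; apply: cstar_subZ.
- by split; [|rewrite /= (star_homM hf) //]; apply: cstar_subM.
- by split; [|rewrite /= (star_homV hf) //]; apply: cstar_subV.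
- have Sx : S x.
    by apply: (cstar_sub_closed hS) => e /hx[y [Sy _] xy]; exists y.
  split=> //; apply: (cstar_sub_closed hT) => e /hx[y [Sy Ty] xy].
  exists (f y) => //; rewrite -star_homB //.
  by apply: le_lt_trans xy; apply: star_hom_contractive; apply: cstar_subB.
Qed.

End StarHomTheory.

(** * Restriction and equalizers of *-homomorphisms *)

Section StarHomPairs.
Context {R : realType} {A B : cstarAlgType R}.

Lemma star_hom_sub (S T : set A) (f : A -> B) :
  S `<=` T -> star_hom T f -> star_hom S f.
Proof.
move=> ST hf; split=> [x y /ST Sx /ST Sy|c x /ST Sx|x y /ST Sx /ST Sy|x /ST Sx].
- exact: (star_homD hf).
- exact: (star_homZ hf).
- exact: (star_homM hf).
- exact: (star_homV hf).
Qed.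

(** With [cstar_span_min], this reduces equality of two homomorphisms to generators. Closedness
    again rests on contractivity. *)
Lemma star_hom_equalizer (S : set A) (f g : A -> B) :
  cstar_subalgebra S -> S 1 -> star_hom S f -> star_hom S g ->
  f 1 = 1 -> g 1 = 1 ->
  cstar_subalgebra (S `&` [set x | f x = g x]).
Proof.
move=> hS S1 hf hg f1 g1.
split=> [|x y [Sx fx] [Sy fy]|c x [Sx fx]|x y [Sx fx] [Sy fy]|x [Sx fx]|x hx].
- by split; [exact: cstar_sub0|rewrite /= (star_hom0 hS hf) (star_hom0 hS hg)].
- split; first exact: cstar_subD.
  by rewrite /= (star_homD hf) // (star_homD hg) // fx fy.
- split; first exact: cstar_subZ.
  by rewrite /= (star_homZ hf) // (star_homZ hg) // fx.
- split; first exact: cstar_subM.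
  by rewrite /= (star_homM hf) // (star_homM hg) // fx fy.
- split; first exact: cstar_subV.
  by rewrite /= (star_homV hf) // (star_homV hg) // fx.
- have Sx : S x.
    by apply: (cstar_sub_closed hS) => e /hx[y [Sy _] xy]; exists y.
  split=> //=; apply/subr0_eq; apply: (@cnorm_lim0 _ _ 2) => e.
  move=> /hx[y [Sy fy] xy]; have Sxy := cstar_subB hS Sx Sy.
  have := cnorm_dist (f x) (f y) (g x).
  rewrite {2}fy (cnormC (g y)) -(star_homB hS hf) // -(star_homB hS hg) //.
  have := star_hom_contractive hS hf S1 f1 Sxy.
  have := star_hom_contractive hS hg S1 g1 Sxy.
  by move: xy; lra.
Qed.

End StarHomPairs.

(** * The group of unitaries of a C*-subalgebra *)

Section UnitaryGroup.
Context {R : realType} {A : cstarAlgType R}.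
Implicit Types x y : A.

Lemma unitary1 : unitary (1 : A).
Proof. by rewrite /unitary star1 mulr1. Qed.

Lemma unitaryM x y : unitary x -> unitary y -> unitary (x * y).
Proof.
move=> [x1 x2] [y1 y2]; rewrite /unitary starM; split.
  by rewrite mulrA -(mulrA (star y)) x1 mulr1.
by rewrite mulrA -(mulrA x) y2 mulr1.
Qed.

Lemma unitaryV x : unitary x -> unitary (star x).
Proof. by move=> [x1 x2]; rewrite /unitary starK. Qed.

(** Packaged as a type so that it can be a target in the universal property of the free group. The
    proofs [hS] and [S1] are parameters because the group operations depend on them. *)
Record unitary_in (S : set A) (hS : cstar_subalgebra S) (S1 : S 1) :=
  UnitaryIn { unitary_val : A ;
              _ : `[< S unitary_val /\ unitary unitary_val >] }.

Variables (S : set A) (hS : cstar_subalgebra S) (S1 : S 1).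
Local Notation U := (unitary_in hS S1).

HB.instance Definition _ := [isSub of U for @unitary_val S hS S1].
HB.instance Definition _ := [Choice of U by <:].

Lemma unitary_valP (x : U) : S (unitary_val x) /\ unitary (unitary_val x).
Proof. by case: x => x /= /asboolP. Qed.

Definition unitary_of x (Sx : S x) (ux : unitary x) : U :=
  @UnitaryIn S hS S1 x (asboolT (conj Sx ux)).

Definition unitary_in_one : U := unitary_of S1 unitary1.

Definition unitary_in_mul (x y : U) : U :=
  unitary_of (cstar_subM hS (unitary_valP x).1 (unitary_valP y).1)
             (unitaryM (unitary_valP x).2 (unitary_valP y).2).

Definition unitary_in_inv (x : U) : U :=
  unitary_of (cstar_subV hS (unitary_valP x).1) (unitaryV (unitary_valP x).2).

Fact unitary_in_mulA : associative unitary_in_mul.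
Proof. by move=> x y z; apply: val_inj; rewrite /= mulrA. Qed.

Fact unitary_in_1mul : left_id unitary_in_one unitary_in_mul.
Proof. by move=> x; apply: val_inj; rewrite /= mul1r. Qed.

Fact unitary_in_mul1 : right_id unitary_in_one unitary_in_mul.
Proof. by move=> x; apply: val_inj; rewrite /= mulr1. Qed.

Fact unitary_in_Vmul : left_inverse unitary_in_one unitary_in_inv unitary_in_mul.
Proof. by move=> x; apply: val_inj; rewrite /= (unitary_valP x).2.1. Qed.

Fact unitary_in_mulV :
  right_inverse unitary_in_one unitary_in_inv unitary_in_mul.
Proof. by move=> x; apply: val_inj; rewrite /= (unitary_valP x).2.2. Qed.

HB.instance Definition _ :=
  isGroup.Build U unitary_in_mulA unitary_in_1mul unitary_in_mul1
    unitary_in_Vmul unitary_in_mulV.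

End UnitaryGroup.

(** Both representations are homomorphisms into the unitary group of [A], where the uniqueness half
    of [free_group] applies. *)
Lemma free_group_unitary_ext {R : realType} {A : cstarAlgType R} (m : nat)
    (F : groupType) (g : 'I_m -> F) (v w : F -> A) :
  free_group g -> unitary_rep v -> unitary_rep w ->
  (forall i, v (g i) = w (g i)) -> v = w.
Proof.
move=> hF [vM vU] [wM wU] vw.
pose lft (u : F -> A) (uU : forall x, unitary (u x)) x : 
    unitary_in (@cstar_subalgebraT R A) I := unitary_of _ I I (uU x).
have [f [_ f_uniq]] := hF _ (fun i => lft w wU (g i)).
have fv : f = lft v vU.
  apply: f_uniq; split=> [x y|i]; apply: val_inj => /=; last exact: vw.
  exact: vM.
have fw : f = lft w wU.
  by apply: f_uniq; split=> [x y|i]; apply: val_inj => //=; exact: wM.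
by apply/funext => x; have := congr1 (fun h => val (h x)) fw; rewrite fv.
Qed.

(** * Consequences of the relations for [K_n] *)

Section KnAlgebra.
Context {R : realType} {A : cstarAlgType R} (n : nat).
Variable u : 'I_n * 'I_n -> A.
Hypothesis hu : KnRelations u.

(** Here the unitarity of the transpose enters; the next two identities come from [U] itself. *)
Lemma Kn_row_initial i k :
  \sum_j star (u (i, j)) * u (k, j) = (i == k)%:R.
Proof.
have [[_ [hT _]] _ _] := hu.
move/matrixP/(_ i k): hT; rewrite !mxE => <-.
by apply: eq_bigr => j _; rewrite !mxE.
Qed.

Lemma Kn_col_initial i k :
  \sum_j star (u (j, i)) * u (j, k) = (i == k)%:R.
Proof.
have [[[hU _] _] _ _] := hu.
move/matrixP/(_ i k): hU; rewrite !mxE => <-.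
by apply: eq_bigr => j _; rewrite !mxE.
Qed.

Lemma Kn_row_final i k :
  \sum_j u (i, j) * star (u (k, j)) = (i == k)%:R.
Proof.
have [[[_ hU] _] _ _] := hu.
move/matrixP/(_ i k): hU; rewrite !mxE => <-.
by apply: eq_bigr => j _; rewrite !mxE.
Qed.

(** For fixed [i] the [qut_p u i j] sum to 1, and the row relation kills every term of
    [u (i, k) * \sum_j qut_p u i j] except [j = k]. *)
Lemma Kn_mul_p i k l :
  u (i, k) * qut_p u i l = if k == l then u (i, k) else 0.
Proof.
have [_ hrow _] := hu; rewrite /qut_p.
case: eqP => [<-|/eqP kl]; last by rewrite mulrA hrow // mul0r.
have sum1 : \sum_j star (u (i, j)) * u (i, j) = 1.
  by rewrite Kn_row_initial eqxx.
rewrite -[RHS]mulr1 -sum1 mulr_sumr.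
rewrite (bigD1 k) //= big1 ?addr0 // => j jk.
by rewrite mulrA hrow ?mul0r // eq_sym.
Qed.

Lemma star_qut_p i k : star (qut_p u i k) = qut_p u i k.
Proof. by rewrite /qut_p starM starK. Qed.

(* Column [x] of [U] is orthogonal to column [y]; multiplying this relation by
   [p_{i,x}] kills all terms but the one of row [i]. *)
Lemma Kn_row_orthogonal i x y : x != y -> star (u (i, x)) * u (i, y) = 0.
Proof.
move=> xy; have [_ _ hcol] := hu.
have : qut_p u i x * \sum_j star (u (j, x)) * u (j, y) = 0.
  by rewrite Kn_col_initial (negPf xy) mulr0.
rewrite mulr_sumr (bigD1 i) //= big1 => [|j ji].
  rewrite addr0 mulrA -star_qut_p -starM Kn_mul_p eqxx //.
by rewrite mulrA /qut_p -(mulrA _ (u (i, x))) hcol 1?eq_sym // mulr0 mul0r.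
Qed.

Definition row_sum i := \sum_x u (i, x).

(** The cross terms vanish, by [Kn_row_orthogonal] on one side and by the row relation on the other;
    the diagonal terms sum to 1. *)
Lemma row_sum_unitary i : unitary (row_sum i).
Proof.
have [_ hrow _] := hu.
rewrite /unitary /row_sum star_sum; split.
- have sum1 : \sum_j star (u (i, j)) * u (i, j) = 1.
    by rewrite Kn_row_initial eqxx.
  rewrite big_distrlr /= -sum1.
  apply: eq_bigr => x _; rewrite (bigD1 x) //= big1 ?addr0 // => y yx.
  by rewrite Kn_row_orthogonal // eq_sym.
- have sum1 : \sum_j u (i, j) * star (u (i, j)) = 1.
    by rewrite Kn_row_final eqxx.
  rewrite big_distrlr /= -sum1.
  apply: eq_bigr => x _; rewrite (bigD1 x) //= big1 ?addr0 // => y yx.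
  by rewrite hrow // eq_sym.
Qed.

Lemma row_sum_mul_p i k : row_sum i * qut_p u i k = u (i, k).
Proof.
rewrite /row_sum mulr_suml (bigD1 k) //= Kn_mul_p eqxx big1 ?addr0 // => j jk.
by rewrite Kn_mul_p (negPf jk).
Qed.

Lemma Kn_word i j k l :
  star (u (i, j)) * u (k, l) =
  qut_p u i j * (star (row_sum i) * row_sum k) * qut_p u k l.
Proof.
rewrite -{1}row_sum_mul_p -{1}(row_sum_mul_p k l).
by rewrite starM star_qut_p !mulrA.
Qed.

Lemma star_row_sumM i k :
  star (row_sum i) * row_sum k = \sum_x \sum_y star (u (i, x)) * u (k, y).
Proof. by rewrite /row_sum star_sum big_distrlr. Qed.

Lemma CQut_subalgebra : cstar_subalgebra (CQut u).
Proof. exact: cstar_span_subalgebra. Qed.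

Lemma CQut_word i j k l : CQut u (star (u (i, j)) * u (k, l)).
Proof. by apply: cstar_span_gen; exists i, j, k, l. Qed.

Lemma CQut_row_sum i k : CQut u (star (row_sum i) * row_sum k).
Proof.
rewrite star_row_sumM; do 2 apply: cstar_sub_sum CQut_subalgebra _ => ? _.
exact: CQut_word.
Qed.

(** The index witnesses that [n] is positive: no words exist for [n = 0]. *)
Lemma CQut1 : 'I_n -> CQut u 1.
Proof. by move=> i; rewrite -(row_sum_unitary i).1; apply: CQut_row_sum. Qed.

End KnAlgebra.

Lemma qut_uE {R : realType} {A : cstarAlgType R} n
    (u : 'I_n.+1 * 'I_n.+1 -> A) (i : 'I_n) :
  qut_u u i =
  star (row_sum u (widen_ord (leqnSn n) i)) * row_sum u (lift ord0 i).
Proof. by rewrite star_row_sumM. Qed.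

Lemma diag_KnRelations {R : realType} {A : cstarAlgType R} n (v : 'I_n -> A) :
  (forall i, unitary (v i)) ->
  KnRelations (fun ij => if ij.1 == ij.2 then v ij.1 else 0).
Proof.
move=> hv.
(* Of two distinct positions in one row or one column, at most one is diagonal. *)
have off (b c : bool) (x y : A) : ~~ (b && c) ->
    (if b then x else 0) * star (if c then y else 0) = 0.
  by case: b; case: c; rewrite ?star0 ?mulr0 ?mul0r.
split=> [|i k l kl|i j k ij] /=; last 2 first.
- by apply: off; apply: contra kl => /andP[/eqP <- /eqP <-].
- by apply: off; apply: contra ij => /andP[/eqP -> /eqP ->].
pose M := \matrix_(i, j) (if i == j then v i else 0) : 'M[A]_n.
have MT : M^T = M.
  by apply/matrixP => i j; rewrite !mxE eq_sym; case: eqP => // ->.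
suff hM : unitary_mx M by split; rewrite ?MT.
split; apply/matrixP => i j; rewrite !mxE (bigD1 i) //= big1 => [|k ki].
- rewrite !mxE eqxx addr0; case: eqP => [->|_]; last by rewrite mulr0.
  by have [-> _] := hv j.
- by rewrite !mxE (negPf ki) star0 mul0r.
- rewrite !mxE eqxx addr0 [j == i]eq_sym; case: eqP => [->|_].
    by have [_ ->] := hv j.
  by rewrite star0 mulr0.
- by rewrite !mxE eq_sym (negPf ki) mul0r.
Qed.

(** * Construction, surjectivity and uniqueness of the homomorphism *)

Theorem corollary1 (R : realType) (n : nat)
    (A : cstarAlgType R) (u : 'I_n.+1 * 'I_n.+1 -> A)
    (hA : universal_cstar (@KnRelations R n.+1) u)
    (F : groupType) (g : 'I_n -> F) (hF : free_group g)
    (B : cstarAlgType R) (w : F -> B) (hB : full_group_cstar w) :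
  let assignment (f : A -> B) :=
    (forall a x : 'I_n.+1, f (qut_p u a x) = (a == x)%:R) /\
    (forall i : 'I_n, f (qut_u u i) = w (g i)) in
  exists phi : A -> B,
    [/\ star_hom (CQut u) phi,
        assignment phi,
        phi @` CQut u = setT
      & forall psi : A -> B, star_hom (CQut u) psi -> assignment psi ->
          {in CQut u, psi =1 phi}].
Proof.
move=> assignment.
have hu := universal_rel hA.
have hC := CQut_subalgebra u; have C1 := CQut1 hu ord0.
have [wM wU] := universal_rel hB.
(* The partial products of the [w (g i)], continued by the factor 1 beyond index [n] so that [v] is
   defined on all of [nat]. *)
pose v := nat_rect (fun _ => B) 1
  (fun k x => x * if insub k is Some i then w (g i) else 1).
have vU k : unitary (v k).
  elim: k => [|k IH]; first exact: unitary1.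
  by apply: unitaryM => //; case: insub => [i|]; [exact: wU|exact: unitary1].
have vS (i : 'I_n) : star (v i) * v i.+1 = w (g i).
  by rewrite /= valK mulrA (vU i).1 mul1r.
have [phi [hphi phi1 phiu]] :=
  universal_map hA (diag_KnRelations (fun i : 'I_n.+1 => vU i)).
have hphiC : star_hom (CQut u) phi by apply: star_hom_sub hphi.
have phi_row i : phi (row_sum u i) = v i.
  rewrite (star_hom_sum (@cstar_subalgebraT R A) hphi) //.
  rewrite (bigD1 i) //= phiu eqxx big1 ?addr0 // => x xi.
  by rewrite phiu /= eq_sym (negPf xi).
have phi_p : assignment phi.
  split=> [a x|i].
    rewrite /qut_p (star_homM hphi) // (star_homV hphi) // !phiu /=.
    case: eqP => _; last by rewrite mulr0.
    by rewrite (vU a).1.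
  rewrite qut_uE (star_homM hphi) // (star_homV hphi) // !phi_row.
  exact: vS.
exists phi; split=> //.
- have zC i : CQut u (qut_u u i) by rewrite qut_uE; apply: CQut_row_sum.
  have zU i : unitary (qut_u u i).
    rewrite qut_uE; apply: unitaryM; last exact: row_sum_unitary.
    by apply: unitaryV; apply: row_sum_unitary.
  (* The target is the unitary group of [CQut u] rather than of [A], which keeps the section inside
     [CQut u]. *)
  have [r [[rM rg] _]] := hF _ (fun i => unitary_of hC C1 (zC i) (zU i)).
  have rR : unitary_rep (fun h => val (r h)).
    by split=> [x y|x]; [rewrite rM|have [] := unitary_valP (r x)].
  have [psi [hpsi psi1 psiw]] := universal_map hB rR.
  (* Both sides are unitary representations of [F] that agree on the free generators. *)
  have phir h : phi (val (r h)) = w h.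
    have pR : unitary_rep (fun h => phi (val (r h))).
      split=> [x y|x]; first by rewrite rM (star_homM hphi).
      exact: (star_hom_unitary (@cstar_subalgebraT R A) hphi phi1 I (rR.2 x)).
    have := @free_group_unitary_ext _ _ _ _ _ _ _ hF pR (conj wM wU).
    move=> /(_ _)/(congr1 (fun f => f h)); apply => i.
    by rewrite rg /=; apply: phi_p.2.
  have psiC b : CQut u (psi b).
    suff: [set: B] `<=` [set b | CQut u (psi b)] by apply.
    rewrite -(universal_gen hB); apply: cstar_span_min.
      have := star_hom_preimage (@cstar_subalgebraT R B) hpsi I psi1 hC.
      by rewrite setTI.
    move=> _ [->|[h _ <-]] /=; first by rewrite psi1.
    by rewrite psiw; have [] := unitary_valP (r h).
  have psiK b : phi (psi b) = b.
    have hcomp : star_hom setT (phi \o psi).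
      split=> [x y|c x|x y|x] _ *; rewrite /=.
      - by rewrite (star_homD hpsi) // (star_homD hphi).
      - by rewrite (star_homZ hpsi) // (star_homZ hphi).
      - by rewrite (star_homM hpsi) // (star_homM hphi).
      - by rewrite (star_homV hpsi) // (star_homV hphi).
    have hid : star_hom [set: B] id by [].
    have hE := star_hom_equalizer (@cstar_subalgebraT R B) I hcomp hid.
    suff /(_ b I)[] : [set: B] `<=`
        [set: B] `&` [set x | (phi \o psi) x = id x] by [].
    rewrite -{1}(universal_gen hB); apply: cstar_span_min.
      by apply: hE => //=; rewrite psi1.
    by move=> _ [->|[h _ <-]]; split=> //=; rewrite ?psi1 ?psiw.
  by apply/seteqP; split=> // b _; exists (psi b).
- move=> psi hpsi [psip psiz] x /set_mem Cx.
  have pC i j : CQut u (qut_p u i j) by apply: CQut_word.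
  (* The unit is the sum of the [qut_p u ord0 j], whose images under [psi] are prescribed. *)
  have psi1 : psi 1 = 1.
    have sum1 : \sum_j qut_p u ord0 j = 1 by rewrite Kn_row_initial // eqxx.
    rewrite -sum1 (star_hom_sum hC hpsi) // (bigD1 ord0) //= psip eqxx.
    by rewrite big1 ?addr0 // => j j0; rewrite psip eq_sym (negPf j0).
  have hE := star_hom_equalizer hC C1 hpsi hphiC psi1 phi1.
  set E := _ `&` _ in hE.
  have Ep i j : E (qut_p u i j) by split=> //=; rewrite psip phi_p.1.
  (* Telescoping: with [s_k] the row sums, [s_0^* s_{k+1} = (s_0^* s_k) (s_k^* s_{k+1})], since
     [s_k s_k^* = 1]. *)
  have E0 k (kn : (k < n.+1)%N) :
      E (star (row_sum u ord0) * row_sum u (Ordinal kn)).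
    elim: k kn => [|k IH] kn.
      have -> : Ordinal kn = ord0 by apply: val_inj.
      by rewrite (row_sum_unitary hu ord0).1; split=> //=; rewrite psi1 phi1.
    have kn' : (k < n)%N by [].
    have Ez : E (qut_u u (Ordinal kn')).
      by split; [rewrite qut_uE; apply: CQut_row_sum|rewrite /= psiz phi_p.2].
    have := cstar_subM hE (IH (leqW kn')) Ez.
    rewrite qut_uE.
    have -> : widen_ord (leqnSn n) (Ordinal kn') = Ordinal (leqW kn').
      exact: val_inj.
    have -> : lift ord0 (Ordinal kn') = Ordinal kn by apply: val_inj.
    by rewrite mulrA -(mulrA _ (row_sum u _)) (row_sum_unitary hu _).2 mulr1.
  have E0' i : E (star (row_sum u ord0) * row_sum u i).
    by case: i => k kn; apply: E0.
  suff [] : E x by [].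
  apply: (cstar_span_min hE) Cx => _ [i [j [k [l ->]]]].
  rewrite (Kn_word hu); apply: (cstar_subM hE) => //.
  apply: (cstar_subM hE) => //.
  (* Inserting [s_0 s_0^* = 1] splits the middle factor into [(s_0^* s_i)^*] times [s_0^* s_k]. *)
  rewrite -[star _]mulr1 -(row_sum_unitary hu ord0).2 mulrA -mulrA.
  apply: (cstar_subM hE) => //.
  by have := cstar_subV hE (E0' i); rewrite starM starK.
Qed.
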